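(* Suppose that $u, s, t$ are positive integers, $n=2 \cdot 3^u$, $1 \leq s, t \leq 3^u$, and $s \neq t$. Then $\chi(C_n, \{s,t\}) \in \{2,3\}$, and both values occur (for suitable choices of such $s,t$).
   Context: $C_n$ is the cycle with vertex set $\mathbb{Z}_n=\{0,1,\dots,n-1\}$, $i$ adjacent to $i\pm1 \pmod n$; the graph distance is $\mathrm{dist}(i,j)=\min(|i-j|,\,n-|i-j|)$. For a set $D$ of positive integers, the distance graph $G(C_n,D)$ has vertex set $\mathbb{Z}_n$, with distinct $i,j$ adjacent iff $\mathrm{dist}(i,j)\in D$; $\chi(C_n,D)$ is its chromatic number. *)

(* Defs.v *)
From mathcomp Require Import all_boot all_order all_algebra.
Set Implicit Arguments.
Unset Strict Implicit.
Unset Printing Implicit Defensive.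

Record sgraph := SGraph {
  svertex :> finType;
  sedge : rel svertex;
  sedge_sym : symmetric sedge;
  sedge_irr : irreflexive sedge
}.

Definition colorable (G : sgraph) (k : nat) : bool :=
  [exists f : {ffun G -> 'I_k},
    [forall x : G, forall y : G, sedge x y ==> (f x != f y)]].

Lemma colorable_card (G : sgraph) : colorable G #|G|.
Proof.
apply/existsP; exists [ffun x => enum_rank x].
apply/forallP=> x; apply/forallP=> y; apply/implyP=> exy.
rewrite !ffunE (inj_eq enum_rank_inj).
by apply: contraTneq exy => ->; rewrite sedge_irr.
Qed.

Lemma ex_colorable (G : sgraph) : exists k, colorable G k.
Proof. by exists #|G|; apply: colorable_card. Qed.

Definition chromatic_number (G : sgraph) : nat := ex_minn (ex_colorable G).

(* In `|i - j|%N the subtraction is the one of int, not truncated. *)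
Definition cycle_dist (n : nat) (i j : 'I_n) : nat :=
  minn `|i - j|%N (n - `|i - j|%N).

Lemma cycle_distC (n : nat) (i j : 'I_n) : cycle_dist i j = cycle_dist j i.
Proof. by rewrite /cycle_dist distnC. Qed.

Definition dist_adj (n : nat) (D : {pred nat}) : rel 'I_n :=
  fun i j => (i != j) && (cycle_dist i j \in D).

Lemma dist_adj_sym (n : nat) (D : {pred nat}) : symmetric (@dist_adj n D).
Proof. by move=> i j; rewrite /dist_adj eq_sym cycle_distC. Qed.

Lemma dist_adj_irr (n : nat) (D : {pred nat}) : irreflexive (@dist_adj n D).
Proof. by move=> i; rewrite /dist_adj eqxx. Qed.

Definition cycle_distance_graph (n : nat) (D : {pred nat}) : sgraph :=
  SGraph (@dist_adj_sym n D) (@dist_adj_irr n D).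

Definition chi_cycle (n : nat) (D : {pred nat}) : nat :=
  chromatic_number (cycle_distance_graph n D).

(* Main.v *)
(** Colour [x] by a periodic function of [x], writing [s = 3^a s'], [t = 3^b t']
    with [s'], [t'] prime to 3 and [a <= b].  If [a = b], the digit of [x] at
    position [a] in base 3 changes along both steps.  If [b = u], then
    [t = 3^u] is odd and either parity, or [x %/ 3^a] shifted by the parity of
    [x], is proper.  If [a < b < u], put [T = 3^(b - a)] and choose [v] inverse
    to [s'] modulo [3T]: then [y = v (x %/ 3^a)] moves by [1] along [s] and by
    [T] times a number prime to 3 along [t], and [y + y %/ T] modulo 3 changes
    in both cases, with period [3T]. *)
Require Import Defs.
From mathcomp Require Import all_boot all_order all_algebra.
From mathcomp Require Import zify.

(** Widening ordinals makes colourability monotone in the number of colours, so failure at [k.-1]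
    alone excludes every smaller number. *)
Lemma colorable_chromatic_number (G : sgraph) (k : nat) :
  colorable G k -> ~~ colorable G k.-1 -> chromatic_number G = k.
Proof.
rewrite /chromatic_number; case: ex_minnP => m Cm min_m Ck nCk.
apply/eqP; rewrite eqn_leq min_m //= leqNgt.
apply: contra nCk => lt_mk.
have le_mk : m <= k.-1 by lia.
move: Cm => /existsP[f /forallP col_f]; apply/existsP.
exists [ffun x => widen_ord le_mk (f x)].
apply/forallP => x; apply/forallP => y; apply/implyP => exy; rewrite !ffunE.
have /forallP/(_ y)/implyP/(_ exy) := col_f x.
by apply: contraNneq => /(congr1 val) /= eq_f; apply/eqP/val_inj.
Qed.

(** Periodicity absorbs the wrap-around of the cycle, so only forward steps in [nat] need
    checking. *)
Lemma periodic_colorable (n k : nat) (D : {pred nat}) (f : nat -> nat) :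
  (forall x, f x < k) -> (forall x, f (x + n) = f x) ->
  (forall d x, d \in D -> f (x + d) <> f x) ->
  colorable (cycle_distance_graph n D) k.
Proof.
move=> f_lt f_per f_step; apply/existsP.
exists [ffun x : 'I_n => Ordinal (f_lt x)].
apply/forallP => i; apply/forallP => j; apply/implyP.
rewrite /= /dist_adj !ffunE => /andP[_ Dij]; apply/eqP => /(congr1 val) /= eq_f.
have lt_in := ltn_ord i; have lt_jn := ltn_ord j.
move: Dij; set d := cycle_dist i j => Dd.
(* The shorter arc starts at [i] or at [j], and either stays below [n] or wraps around once. *)
have: [\/ j = i + d :> nat, i = j + d :> nat, j + d = i + n | i + d = j + n].
  rewrite /d /cycle_dist; case: (leqP i j) => le_ij.
    by case: (leqP (j - i) (n - (j - i))) => ?;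
      [constructor 1 | constructor 3]; lia.
  by case: (leqP (i - j) (n - (i - j))) => ?;
    [constructor 2 | constructor 4]; lia.
case=> eq_ij.
- by apply: (f_step d i Dd); rewrite -eq_ij.
- by apply: (f_step d j Dd); rewrite -eq_ij.
- by apply: (f_step d j Dd); rewrite eq_ij f_per.
- by apply: (f_step d i Dd); rewrite eq_ij f_per.
Qed.

Lemma dist_adj_addr (n d : nat) (D : {pred nat}) (i j : 'I_n) :
  0 < d -> 2 * d <= n -> d \in D -> j = i + d :> nat -> dist_adj D i j.
Proof.
move=> d_gt0 le_dn Dd def_j; apply/andP; split.
  by apply: contraTneq d_gt0 => eq_ij; move: def_j; rewrite eq_ij; lia.
by have -> : cycle_dist i j = d by rewrite /cycle_dist; lia.
Qed.

Lemma cycle_distance_graph_not_1colorable (n d : nat) (D : {pred nat}) :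
  0 < d -> 2 * d <= n -> d \in D -> ~~ colorable (cycle_distance_graph n D) 1.
Proof.
move=> d_gt0 le_dn Dd; apply/existsP => -[f /forallP col_f].
have lt0n : 0 < n by lia.
have ltdn : d < n by lia.
have /forallP/(_ (Ordinal ltdn))/implyP/(_ _)/eqP := col_f (Ordinal lt0n).
by apply; [apply: (@dist_adj_addr _ d) | rewrite !ord1].
Qed.

(** The vertices 0, [d] and [2 * d] form a triangle; [4 * d <= n] makes the distance from 0 to
    [2 * d] equal to [2 * d]. *)
Lemma cycle_distance_graph_not_2colorable (n d : nat) (D : {pred nat}) :
  0 < d -> 4 * d <= n -> d \in D -> 2 * d \in D ->
  ~~ colorable (cycle_distance_graph n D) 2.
Proof.
move=> d_gt0 le_dn Dd Dd2; apply/existsP => -[f /forallP col_f].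
have lt0n : 0 < n by lia.
have ltdn : d < n by lia.
have lt2dn : 2 * d < n by lia.
have col (i j : 'I_n) : dist_adj D i j -> f i <> f j :> nat.
  move=> eij; have /forallP/(_ j)/implyP/(_ eij)/eqP nf := col_f i.
  by move=> eq_f; apply: nf; apply: val_inj.
pose x0 := Ordinal lt0n; pose x1 := Ordinal ltdn; pose x2 := Ordinal lt2dn.
have n01 : f x0 <> f x1 :> nat.
  by apply: col; apply: (@dist_adj_addr _ d) => //; lia.
have n12 : f x1 <> f x2 :> nat.
  by apply: col; apply: (@dist_adj_addr _ d) => //=; lia.
have n02 : f x0 <> f x2 :> nat.
  by apply: col; apply: (@dist_adj_addr _ (2 * d)) => //; lia.
by have := ltn_ord (f x0); have := ltn_ord (f x1); have := ltn_ord (f x2); lia.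
Qed.

Lemma odd_colorable (n k s t : nat) :
  1 < k -> ~~ odd n -> odd s -> odd t ->
  colorable (cycle_distance_graph n (pred2 s t)) k.
Proof.
move=> lt1k even_n odd_s odd_t; apply: (@periodic_colorable _ _ _ odd).
- by move=> x; apply: leq_ltn_trans lt1k; case: odd.
- by move=> x; rewrite oddD (negPf even_n) addbF.
- by move=> d x; rewrite inE => /orP[]/eqP->; rewrite oddD ?odd_s ?odd_t; case: odd.
Qed.

(** For [T = 3 ^ c] with [0 < c], this is the sum modulo 3 of the base 3 digits of [y] at positions
    0 and [c]. *)
Definition digit_sum3 (T y : nat) := (y + y %/ T) %% 3.

(** The quotient [y %/ T] grows by 0 or 1, so the sum grows by 1 or 2, never by a multiple of 3. *)
Lemma digit_sum3_succ (T y : nat) :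
  0 < T -> digit_sum3 T (y + 1) <> digit_sum3 T y.
Proof. by move=> T_gt0; rewrite /digit_sum3 addn1 divnS //; case: dvdn; lia. Qed.

Lemma digit_sum3_add (T y w : nat) :
  0 < T -> 3 %| T -> digit_sum3 T (y + w * T) = (digit_sum3 T y + w) %% 3.
Proof.
move=> T_gt0 /dvdnP[c def_T]; rewrite /digit_sum3 [y + _]addnC divnMDl // modnDml.
by rewrite {1}def_T mulnA; lia.
Qed.

Lemma factor3 (m : nat) : 0 < m -> exists a m', m = m' * 3 ^ a /\ ~~ (3 %| m').
Proof.
move=> m_gt0; exists (logn 3 m).
have [m' co_m' def_m] := @pfactor_coprime 3 m isT m_gt0.
by exists m'; rewrite -prime_coprime.
Qed.

Lemma divn_pow3_step (a x w : nat) : (x + w * 3 ^ a) %/ 3 ^ a = x %/ 3 ^ a + w.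
Proof. by rewrite addnC divnMDl ?expn_gt0 // addnC. Qed.

Lemma equal_valuation_colorable (a s' t' m : nat) :
  ~~ (3 %| s') -> ~~ (3 %| t') ->
  colorable (cycle_distance_graph (3 * m * 3 ^ a)
               (pred2 (s' * 3 ^ a) (t' * 3 ^ a))) 3.
Proof.
move=> s'_not3 t'_not3.
apply: (@periodic_colorable _ _ _ (fun x => (x %/ 3 ^ a) %% 3)).
- by move=> x; rewrite ltn_mod.
- by move=> x; rewrite divn_pow3_step; lia.
- by move=> d x; rewrite inE => /orP[]/eqP->; rewrite divn_pow3_step; lia.
Qed.

(** The first step is even: it keeps the parity and moves the quotient by [s']. The second is odd:
    it flips the parity and moves the quotient by [3 * m], which vanishes modulo 3. *)
Lemma even_odd_colorable (a s' m : nat) :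
  ~~ (3 %| s') -> ~~ odd s' -> odd m ->
  colorable (cycle_distance_graph (2 * (3 * m * 3 ^ a))
               (pred2 (s' * 3 ^ a) (3 * m * 3 ^ a))) 3.
Proof.
move=> s'_not3 even_s' odd_m.
apply: (@periodic_colorable _ _ _ (fun x => (x %/ 3 ^ a + odd x) %% 3)).
- by move=> x; rewrite ltn_mod.
- by move=> x; rewrite mulnA divn_pow3_step oddD !oddM /= addbF; lia.
- move=> d x; rewrite inE => /orP[]/eqP->; rewrite divn_pow3_step oddD !oddM.
    by rewrite (negPf even_s') addbF; lia.
  by rewrite odd_m oddX orbT; case: (odd x) => /=; lia.
Qed.

Lemma unequal_valuation_colorable (a s' c t' m : nat) :
  ~~ (3 %| s') -> ~~ (3 %| t') -> 0 < c ->
  colorable (cycle_distance_graph (3 * m * 3 ^ c * 3 ^ a)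
               (pred2 (s' * 3 ^ a) (t' * 3 ^ c * 3 ^ a))) 3.
Proof.
move=> s'_not3 t'_not3 c_gt0; set T := 3 ^ c.
have T_gt0 : 0 < T by rewrite expn_gt0.
have T_dvd3 : 3 %| T by rewrite dvdn_exp.
have s'_gt0 : 0 < s' by case: (s') s'_not3.
have co_s' : coprime s' (3 * T).
  by rewrite -expnS coprimeXr // coprime_sym prime_coprime.
(* Bezout in [nat]: [v * s' = k * (3 * T) + 1], which also prevents 3 from dividing [v]. *)
have [v k def_v _] := egcdnP (3 * T) s'_gt0.
rewrite (eqP co_s') in def_v.
have v_not3 : ~~ (3 %| v).
  apply/negP => /dvdnP[w def_w]; move: def_v; rewrite def_w; nia.
have vt'_not3 : ~~ (3 %| v * t') by rewrite Euclid_dvdM // negb_or v_not3.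
apply: (@periodic_colorable _ _ _ (fun x => digit_sum3 T (v * (x %/ 3 ^ a)))).
- by move=> x; rewrite ltn_mod.
- move=> x; rewrite divn_pow3_step mulnDr mulnA digit_sum3_add // mulnCA -modnDmr.
  by rewrite modnMr addn0 modn_mod.
- move=> d x; rewrite inE => /orP[]/eqP->; rewrite divn_pow3_step mulnDr.
    (* Besides the 1, [y] moves by [k * 3] times [T], which shifts [digit_sum3] by a multiple of
       3. *)
    set y := v * _; rewrite def_v (addnC _ 1) addnA mulnA digit_sum3_add //.
    rewrite -modnDmr modnMl addn0 modn_mod.
    exact: digit_sum3_succ.
  by rewrite mulnA digit_sum3_add // /digit_sum3; lia.
Qed.

(** This serves to exchange [s] and [t], as [pred2 s t] and [pred2 t s] agree pointwise. *)
Lemma eq_cycle_distance_colorable (n k : nat) (D D' : {pred nat}) :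
  D =i D' -> colorable (cycle_distance_graph n D) k ->
  colorable (cycle_distance_graph n D') k.
Proof.
move=> eqD /existsP[f /forallP col_f]; apply/existsP; exists f.
apply/forallP => i; apply/forallP => j; have /forallP/(_ j) := col_f i.
by rewrite /= /dist_adj eqD.
Qed.

Lemma three_colorable (u s t : nat) :
  1 <= s <= 3 ^ u -> 1 <= t <= 3 ^ u -> s <> t ->
  colorable (cycle_distance_graph (2 * 3 ^ u) (pred2 s t)) 3.
Proof.
move=> /andP[s_gt0 le_s] /andP[t_gt0 le_t] neq_st.
have [a [s' [def_s s'_not3]]] := factor3 _ s_gt0.
have [b [t' [def_t t'_not3]]] := factor3 _ t_gt0.
wlog le_ab : s t s_gt0 le_s t_gt0 le_t neq_st a s' def_s s'_not3
             b t' def_t t'_not3 / a <= b.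
  move=> gen; have [le_ab | /ltnW le_ba] := leqP a b; 
    first exact: (gen s t _ _ _ _ _ a s' _ _ b t').
  apply: (@eq_cycle_distance_colorable _ _ (pred2 t s)).
    by move=> d; rewrite !inE orbC.
  by apply: (gen t s _ _ _ _ _ b t' _ _ a s') => //; apply: nesym.
have s'_gt0 : 0 < s' by case: (s') s'_not3.
have t'_gt0 : 0 < t' by case: (t') t'_not3.
have le_bu : b <= u.
  by rewrite -(@leq_exp2l 3) //; apply: leq_trans le_t; rewrite def_t leq_pmull.
(* If [a = u] then [b = u] as well, and the bound [3 ^ u] forces [s = t = 3 ^ u]. *)
have lt_au : a < u.
  rewrite ltn_neqAle (leq_trans le_ab le_bu) andbT; apply/eqP => eq_au.
  have eq_bu : b = u by lia.
  by move: (expn_gt0 3 u) => /= p_gt0; subst a b; nia.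
move: le_ab; rewrite leq_eqVlt => /predU1P[eq_ab | lt_ab].
  rewrite -eq_ab in def_t; rewrite def_s def_t.
  have -> : 2 * 3 ^ u = 3 * (2 * 3 ^ (u - a).-1) * 3 ^ a.
    by rewrite mulnCA -expnS prednK ?subn_gt0 // -mulnA -expnD subnK // ltnW.
  exact: equal_valuation_colorable.
move: le_bu; rewrite leq_eqVlt => /predU1P[eq_bu | lt_bu].
  have t'1 : t' = 1.
    by move: (expn_gt0 3 u) => /= p_gt0; subst b; nia.
  have def_t3 : t = 3 * 3 ^ (u - a).-1 * 3 ^ a.
    by rewrite -expnS prednK ?subn_gt0 // -expnD subnK ?(ltnW lt_au) // def_t t'1 mul1n eq_bu.
  have def_u : 3 ^ u = t by rewrite def_t t'1 mul1n eq_bu.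
  have [odd_s | even_s] := boolP (odd s).
    apply: odd_colorable => //; first by rewrite oddM.
    by rewrite -def_u oddX orbT.
  rewrite def_u def_t3 def_s; apply: even_odd_colorable => //.
    by move: even_s; rewrite def_s oddM oddX orbT andbT.
  by rewrite oddX orbT.
(* Since [b < u], [n] has a factor 3 beyond [3 ^ b], as the period [3T] demands. *)
have def_n : 2 * 3 ^ u = 3 * (2 * 3 ^ (u - b).-1) * 3 ^ (b - a) * 3 ^ a.
  rewrite mulnCA -expnS prednK ?subn_gt0 // -!mulnA -!expnD subnK ?(ltnW lt_ab) //.
  by rewrite subnK // ltnW.
have def_t3 : t = t' * 3 ^ (b - a) * 3 ^ a.
  by rewrite -mulnA -expnD subnK // ltnW.
rewrite def_n def_t3 def_s.
by apply: unequal_valuation_colorable; rewrite ?subn_gt0.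
Qed.

Theorem theorem3p3p4 (u n : nat) (hu : 0 < u) (hn : n = 2 * 3 ^ u) :
  [/\ forall s t : nat, 1 <= s <= 3 ^ u -> 1 <= t <= 3 ^ u -> s <> t ->
        chi_cycle n (pred2 s t) = 2 \/ chi_cycle n (pred2 s t) = 3,
      exists s t : nat, [/\ 1 <= s <= 3 ^ u, 1 <= t <= 3 ^ u, s <> t
        & chi_cycle n (pred2 s t) = 2]
    & exists s t : nat, [/\ 1 <= s <= 3 ^ u, 1 <= t <= 3 ^ u, s <> t
        & chi_cycle n (pred2 s t) = 3]].
Proof.
have le3 : 3 <= 3 ^ u by rewrite -{1}(expn1 3) leq_exp2l.
rewrite /chi_cycle; split.
- move=> s t s_rng t_rng neq_st.
  have C3 := three_colorable u s t s_rng t_rng neq_st; rewrite -hn in C3.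
  have [C2 | nC2] := boolP (colorable (cycle_distance_graph n (pred2 s t)) 2).
    left; apply: colorable_chromatic_number => //=.
    apply: (@cycle_distance_graph_not_1colorable _ s); last by rewrite inE eqxx.
      by lia.
    by lia.
  by right; apply: colorable_chromatic_number.
(* Both 1 and 3 are odd, so parity is a proper colouring; [0 < u] puts 3 in range. *)
- exists 1, 3; split=> //; first by lia.
  apply: colorable_chromatic_number.
    by apply: odd_colorable => //; rewrite hn oddM.
  by apply: (@cycle_distance_graph_not_1colorable _ 1) => //; lia.
(* The vertices 0, 1, 2 form a triangle, because [n] is at least 6. *)
- exists 1, 2; split=> //; [by lia | by lia |].
  apply: colorable_chromatic_number; first by rewrite hn; apply: three_colorable; lia.
  by apply: (@cycle_distance_graph_not_2colorable _ 1) => //; lia.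
Qed.
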